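(* On any instance $I$ on the real line with $n$ agents and preferred distances bounded by $B$, the Median-Plus mechanism has social cost at most $OPT(I)+nB$.
   Context: An instance with $n\ge1$ agents is $I=\langle (x_1,b_1),\dots,(x_n,b_n)\rangle$, with locations $x_i\in\mathbb{R}$ and preferred distances $b_i\in[0,B]$. The cost of agent $i$ for facility location $y\in\mathbb{R}$ is $cost(y,(x_i,b_i))=|x_i-b_i-y|$ if $y\le x_i$ and $|x_i+b_i-y|$ if $y>x_i$ (equivalently $\big||x_i-y|-b_i\big|$); the social cost is $SC(y,I)=\sum_i cost(y,(x_i,b_i))$ and $OPT(I)=\min_{y\in\mathbb{R}}SC(y,I)$. The median of $n$ items is the item of rank $\lfloor (n+1)/2\rfloor$ in increasing order, ties among equal agent locations being resolved by a fixed ordering of the agents; $\mathrm{med}$ is the median of $x_1,\dots,x_n$. Median-Plus mechanism: for each agent $i$, set $p_i=x_i+b_i$ if $x_i\le\mathrm{med}$ and $p_i=x_i-b_i$ otherwise (for agents with $x_i=\mathrm{med}$ the comparison is resolved by the fixed ordering: $p_i=x_i+b_i$ exactly for agents of rank at most $\lfloor (n+1)/2\rfloor$). Output the median of $p_1,\dots,p_n$ as the facility location. *)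

(* Defs.v *)
From HB Require Import structures.
From mathcomp Require Export all_boot all_order all_algebra all_fingroup.
From mathcomp Require Export all_classical all_reals all_analysis.
From mathcomp Require Import lra.

Set Implicit Arguments.
Unset Strict Implicit.
Unset Printing Implicit Defensive.

Import Order.TTheory GRing.Theory Num.Theory.
Import numFieldNormedType.Exports.
Local Open Scope ring_scope.
Local Open Scope classical_set_scope.

(* Agent i has location (I i).1 and preferred distance (I i).2. *)
Definition instance (R : realType) (n : nat) := 'I_n -> R * R.

Definition loc (R : realType) (n : nat) (I : instance R n) (i : 'I_n) : R :=
  (I i).1.

Definition dist (R : realType) (n : nat) (I : instance R n) (i : 'I_n) : R :=
  (I i).2.

Definition cost (R : realType) (y : R) (a : R * R) : R :=
  if y <= a.1 then `|a.1 - a.2 - y| else `|a.1 + a.2 - y|.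

Definition SC (R : realType) (n : nat) (y : R) (I : instance R n) : R :=
  \sum_(i < n) cost y (I i).

(* The infimum is attained (OPT_attained), so this is the minimum. *)
Definition OPT (R : realType) (n : nat) (I : instance R n) : R :=
  inf [set SC y I | y in [set: R]].

(* The k-th smallest item sits at position k.-1 of the sorted sequence. *)
Definition median_rank (n : nat) : nat := n.+1 %/ 2.

Definition median (R : realType) (s : seq R) : R :=
  nth 0 (sort <=%R s) (median_rank (size s)).-1.

Definition med (R : realType) (n : nat) (I : instance R n) : R :=
  median [seq loc I i | i <- enum 'I_n].

(* A permutation tie encodes the fixed ordering of the agents: agent i comes
   in position tie i. *)
Definition agent_le (R : realType) (n : nat) (tie : {perm 'I_n})
    (I : instance R n) : rel 'I_n := fun i j =>
  (loc I i < loc I j) || ((loc I i == loc I j) && (tie i <= tie j)%N).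

(* Ranks are counted from 1. *)
Definition rank (R : realType) (n : nat) (tie : {perm 'I_n})
    (I : instance R n) (i : 'I_n) : nat :=
  (index i (sort (agent_le tie I) (enum 'I_n))).+1.

Definition le_med (R : realType) (n : nat) (tie : {perm 'I_n})
    (I : instance R n) (i : 'I_n) : bool :=
  (loc I i < med I) ||
  ((loc I i == med I) && (rank tie I i <= median_rank n)%N).

Definition preferred_point (R : realType) (n : nat) (tie : {perm 'I_n})
    (I : instance R n) (i : 'I_n) : R :=
  if le_med tie I i then loc I i + dist I i else loc I i - dist I i.

Definition median_plus (R : realType) (n : nat) (tie : {perm 'I_n})
    (I : instance R n) : R :=
  median [seq preferred_point tie I i | i <- enum 'I_n].

Lemma costE (R : realType) (y : R) (a : R * R) :
  cost y a = `| `|a.1 - y| - a.2 |.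
Proof.
rewrite /cost; case: ifPn => [ya|].
  by rewrite (ger0_norm (x := a.1 - y)) ?subr_ge0// addrAC.
rewrite -ltNge => ay; rewrite (ltr0_norm (x := a.1 - y)) ?subr_lt0//.
by rewrite -normrN; congr (`| _ |); lra.
Qed.

Lemma SC_continuous (R : realType) (n : nat) (I : instance R n) :
  continuous (fun y : R => SC y I).
Proof.
apply: continuous_big => [|i _]; first exact: add_continuous.
rewrite [X in continuous X](_ : _ =
  (fun z : R => `| `|(I i).1 - z| - (I i).2 |)); last first.
  by apply/funext => z; rewrite costE.
move=> y; apply: (@cvg_norm R R); apply: cvgB; last exact: cvg_cst.
by apply: (@cvg_norm R R); apply: cvgB; [exact: cvg_cst|exact: cvg_id].
Qed.

Lemma OPT_attained (R : realType) (n : nat) (I : instance R n) :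
  exists2 y : R, SC y I = OPT I & forall z : R, OPT I <= SC z I.
Proof.
suff [y ymin] : exists y : R, forall z : R, SC y I <= SC z I.
  have lbI : has_lbound [set SC z I | z in [set: R]].
    by exists (SC y I) => _ [z _ <-].
  have leO z : OPT I <= SC z I by apply: ge_inf => //; exists z.
  exists y => //; apply/eqP; rewrite eq_le leO andbT.
  by apply: lb_le_inf => [|_ [z _ <-]//]; exists (SC y I), y.
case: n => [|n] in I *.
  by exists 0 => z; rewrite /SC !big_ord0.
have cost_ge0 y a : 0 <= cost (R := R) y a by rewrite costE.
pose x0 : R := loc I ord0; pose M : R := SC x0 I + `|dist I ord0|.
have M0 : 0 <= M by rewrite addr_ge0// sumr_ge0.
have far z : M <= `|x0 - z| -> SC x0 I <= SC z I.
  move=> Mz; apply: (@le_trans _ _ (cost z (I ord0))).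
    rewrite costE; apply: le_trans (ler_norm _).
    by have := ler_norm (dist I ord0); rewrite /M /x0 /loc /dist in Mz *; lra.
  by rewrite /SC (bigD1 ord0)//= lerDl sumr_ge0.
have [|c _ cmin] := @EVT_min R (fun y => SC y I) (x0 - M) (x0 + M) _
  (continuous_subspaceT (@SC_continuous R n.+1 I)).
  lra.
exists c => z; have [zM|Mz] := ltP `|x0 - z| M; last first.
  apply: le_trans (far z Mz); apply: cmin; rewrite in_itv/=; lra.
apply: cmin; rewrite in_itv/=; move: zM; rewrite ltr_norml; lra.
Qed.

Lemma agent_le_total (R : realType) (n : nat) (tie : {perm 'I_n})
    (I : instance R n) : total (agent_le tie I).
Proof.
by move=> i j; rewrite /agent_le; case: ltgtP => //= _; exact: leq_total.
Qed.

Lemma agent_le_trans (R : realType) (n : nat) (tie : {perm 'I_n})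
    (I : instance R n) : transitive (agent_le tie I).
Proof.
move=> j i k; rewrite /agent_le.
move=> /orP[ij|/andP[/eqP-> tij]] /orP[jk|/andP[/eqP<- tjk]].
- by rewrite (lt_trans ij jk).
- by rewrite ij.
- by rewrite jk.
- by rewrite eqxx (leq_trans tij tjk) orbT.
Qed.

(* The plus side consists exactly of the agents of rank at most that of the
   median agent. *)
Lemma le_medE (R : realType) (n : nat) (tie : {perm 'I_n})
    (I : instance R n) (i : 'I_n) :
  le_med tie I i = (rank tie I i <= median_rank n)%N.
Proof.
pose r := sort (agent_le tie I) (enum 'I_n).
have szr : size r = n by rewrite size_sort size_enum_ord.
have ir : i \in r by rewrite mem_sort mem_enum.
have n0 : (0 < n)%N by apply: leq_ltn_trans (ltn_ord i).
have loc_sorted : sort <=%R [seq loc I j | j <- enum 'I_n] = map (loc I) r.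
  apply: (@sorted_eq _ <=%R); [exact: le_trans|exact: le_anti|..].
  - by apply: sort_sorted; exact: le_total.
  - rewrite sorted_map; apply: sub_sorted (sort_sorted (@agent_le_total _ _ tie I) _).
    by move=> j k /= /orP[/ltW|/andP[/eqP->]].
  - by rewrite perm_sort perm_sym perm_map// perm_sort.
have m0 : (0 < median_rank n)%N by rewrite /median_rank divn_gt0.
have mn : ((median_rank n).-1 < n)%N.
  by rewrite prednK// -ltnS ltn_Pdiv.
have medE : med I = loc I (nth i r (median_rank n).-1).
  by rewrite /med /median size_map size_enum_ord loc_sorted (nth_map i) ?szr.
have mono a b : (a <= b < n)%N -> loc I (nth i r a) <= loc I (nth i r b).
  move=> /andP[ab bn].
  have := sorted_leq_nth (@agent_le_trans _ _ tie I) _ i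
    (sort_sorted (@agent_le_total _ _ tie I) (enum 'I_n)).
  rewrite -/r => H.
  have refl : reflexive (agent_le tie I).
    by move=> j; rewrite /agent_le eqxx leqnn orbT.
  have := H refl a b; rewrite !inE szr => /(_ (leq_ltn_trans ab bn) bn ab).
  by move=> /orP[/ltW|/andP[/eqP->]].
have iE : loc I i = loc I (nth i r (index i r)) by rewrite nth_index.
rewrite /le_med /rank -/r medE.
have [im|mi] := leqP (index i r).+1 (median_rank n).
  rewrite andbT orbC -le_eqVlt {1}iE mono// mn andbT.
  by rewrite -ltnS prednK.
rewrite andbF orbF; apply/negbTE; rewrite -leNgt [leRHS]iE mono//.
have -> : (index i r < n)%N by rewrite -[ltnRHS]szr index_mem.
rewrite andbT; apply: leq_trans (leq_pred _) _.
by rewrite -ltnS.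
Qed.

(* Main.v *)
Require Import Defs.
From mathcomp Require Import zify lra.

Set Implicit Arguments.
Unset Strict Implicit.
Unset Printing Implicit Defensive.

Import Order.TTheory GRing.Theory Num.Theory.
Local Open Scope ring_scope.

(* Every cost is at most |y - p_i|, and the output minimises
   z |-> sum_i |z - p_i|, so it suffices to find one z with
   sum_i |z - p_i| <= OPT + n B.  Let y be an optimal location; then
   |y - p_i| = cost_i(y) for every agent whose point p_i lies on the same side
   of x_i as y, and |y - p_i| <= cost_i(y) + 2B always.
   If med <= y, then z = y works: only the (at most n/2) agents of rank above
   the median can be on the wrong side.
   If y < med, only the agents of rank at most the median can be, which for odd
   n is one too many.  If one of them satisfies |y - p_i| <= cost_i(y) + B,
   then z = y still works.  Otherwise all of them have p_i > y + B, and moving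
   to z = y + B brings each of them closer by B while costing the other agents
   at most B, so that |z - p_i| <= cost_i(y) + B for every agent. *)

(* Pair the entries of ranks i and n - 1 - i of the sorted sequence: the median
   lies between them, so it minimises the sum of the two distances. *)
Lemma median_minimizes_sum_dist (R : realType) (s : seq R) (z : R) :
  \sum_(x <- s) `|median s - x| <= \sum_(x <- s) `|z - x|.
Proof.
have s_perm := permEl (perm_sort <=%R s).
rewrite -[leLHS](perm_big _ s_perm) -[leRHS](perm_big _ s_perm) /=.
rewrite {s_perm} /median -(size_sort <=%R s).
have := sort_sorted (@le_total _ R) s; move: (sort _ s) => {}s s_sorted.
set m := nth 0 s _; rewrite !(big_nth (0 : R)) !big_mkord.
have mono i j : (i <= j < size s)%N -> s`_i <= s`_j.
  move=> /andP[ij js].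
  by apply: (sorted_leq_nth le_trans le_refl) => //;
    rewrite inE // (leq_ltn_trans ij).
(* Doubling the sum lets the middle index of an odd-length list be paired with itself. *)
have double (f : 'I_(size s) -> R) :
    (\sum_i f i) *+ 2 = \sum_i (f i + f (rev_ord i)).
  by rewrite mulr2n big_split /= [X in _ + X = _](reindex_inj rev_ord_inj).
rewrite -(ler_pMn2r (ltn0Sn 1)) !double; apply: ler_sum => i _ /=.
have i_lt := ltn_ord i; have [im|mi] := leqP i (median_rank (size s)).-1.
  have h1 : s`_i <= m by apply: mono; rewrite /median_rank in im *; lia.
  have h2 : m <= s`_(size s - i.+1).
    by apply: mono; rewrite /median_rank in im *; lia.
  rewrite ger0_norm ?subr_ge0// ler0_norm ?subr_le0//.
  have := ler_norm (z - s`_i); have := ler_norm (- (z - s`_(size s - i.+1))).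
  by rewrite normrN; lra.
have h1 : m <= s`_i by apply: mono; rewrite /median_rank in mi *; lia.
have h2 : s`_(size s - i.+1) <= m.
  by apply: mono; rewrite /median_rank in mi *; lia.
rewrite ler0_norm ?subr_le0// ger0_norm ?subr_ge0//.
have := ler_norm (- (z - s`_i)); have := ler_norm (z - s`_(size s - i.+1)).
by rewrite normrN; lra.
Qed.

(** By [le_medE] the plus side is a prefix of the agents sorted by [agent_le], so ties at [med I] do
    not affect its size. *)
Lemma card_le_med (R : realType) (n : nat) (tie : {perm 'I_n})
    (I : instance R n) : (1 <= n)%N ->
  #|[pred i | le_med tie I i]| = median_rank n.
Proof.
move=> n_gt0; pose r := sort (agent_le tie I) (enum 'I_n).
have -> : #|[pred i | le_med tie I i]| = #|take (median_rank n) r|.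
  apply: eq_card => i; rewrite inE le_medE /rank -/r.
  by rewrite in_take// mem_sort mem_enum.
rewrite (card_uniqP _) ?take_uniq ?sort_uniq ?enum_uniq//.
rewrite size_take size_sort size_enum_ord /median_rank.
by case: ifP; lia.
Qed.

Lemma preferred_points_near_cost (R : realType) (n : nat) (tie : {perm 'I_n}) (B : R)
    (I : instance R n) (y : R) (n_ge1 : (1 <= n)%N)
    (dist_bounded : forall i : 'I_n, 0 <= dist I i <= B) :
  exists z : R,
    \sum_(i < n) `|z - preferred_point tie I i| <= SC y I + n%:R * B.
Proof.
set p := preferred_point tie I.
have B0 : 0 <= B.
  by have /andP[/le_trans] := dist_bounded (Ordinal n_ge1); exact.
(* The cost is the distance from [y] to the nearer of [x - b] and [x + b], which are [2 * b]
   apart. *)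
have excess_2B i : `|y - p i| <= cost y (I i) + 2 * B.
  have /andP[] := dist_bounded i.
  rewrite costE /p /preferred_point /loc /dist; case: (I i) => x b /=.
  by case: (ler0P (x - y)) => ?; case: ifP => _;
    rewrite ler_norml; case: ler0P => ?; lra.
have exact_plus i : le_med tie I i -> loc I i <= y -> `|y - p i| = cost y (I i).
  move=> iL; rewrite costE /p /preferred_point iL /loc /dist => xy.
  by rewrite (ler0_norm (x := _ - y)) ?subr_le0//; congr `|_|; lra.
have exact_minus i : ~~ le_med tie I i -> y <= loc I i ->
    `|y - p i| = cost y (I i).
  move=> iR; rewrite costE /p /preferred_point (negbTE iR) /loc /dist => yx.
  by rewrite (ger0_norm (x := _ - y)) ?subr_ge0// -normrN; congr `|_|; lra.
have le_med_loc i : le_med tie I i -> loc I i <= med I.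
  by move=> /orP[/ltW|/andP[/eqP->]].
have gt_med_loc i : ~~ le_med tie I i -> med I <= loc I i.
  by rewrite negb_or -leNgt => /andP[].
have countL := card_le_med tie I n_ge1.
have countR : (#|[pred i | ~~ le_med tie I i]| = n - median_rank n)%N.
  have := cardC [pred i | le_med tie I i]; rewrite card_ord countL.
  move=> /(congr1 (subn^~ (median_rank n))) /=; rewrite addKn => <-.
  by apply: eq_card => i; rewrite !inE.
have excess (A : pred 'I_n) :
    \sum_(i < n) (cost y (I i) + (if A i then 2 * B else 0)) =
    SC y I + (#|A| * 2)%:R * B.
  rewrite big_split /= -big_mkcond sumr_const natrM.
  by rewrite -mulrA !mulr_natl.
have [my|ym] := leP (med I) y.
  exists y; apply: (@le_trans _ _
    (SC y I + (#|[pred i | ~~ le_med tie I i]| * 2)%:R * B)).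
    rewrite -excess; apply: ler_sum => i _ /=.
    case: ifPn => // /negPn iL; rewrite addr0 exact_plus//.
    exact: le_trans (le_med_loc _ iL) my.
  (* The minus side has [n %/ 2] agents. *)
  rewrite lerD2l ler_wpM2r// ler_nat countR /median_rank; lia.
have [/existsP[j /andP[jL jB]]|] :=
    boolP [exists i, le_med tie I i && (`|y - p i| <= cost y (I i) + B)].
  (* Agent [j] is charged [B] and each agent of [A] is charged [2 * B], in total
     [2 * median_rank n - 1 <= n] times [B]. *)
  pose A := [pred i | le_med tie I i & i != j].
  have cardA : #|A|.+1 = median_rank n.
    rewrite -countL (cardD1 j [pred i | le_med tie I i]) inE jL add1n.
    by congr _.+1; apply: eq_card => i; rewrite !inE andbC.
  exists y; apply: (@le_trans _ _ (SC y I + (#|A| * 2)%:R * B + B)).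
    rewrite -excess (bigD1 j)//= [in leRHS](bigD1 j)//= eqxx andbF addr0.
    rewrite addrAC lerD//; apply: ler_sum => i ij.
    case: ifPn => //; rewrite ij andbT => iR; rewrite addr0 exact_minus//.
    exact: le_trans (ltW ym) (gt_med_loc _ iR).
  rewrite -addrA lerD2l -[X in _ + X]mul1r -mulrDl natr1.
  by rewrite ler_wpM2r// ler_nat; move: cardA; rewrite /median_rank; lia.
rewrite negb_exists => /forallP far; exists (y + B).
have -> : SC y I + n%:R * B = \sum_(i < n) (cost y (I i) + B).
  by rewrite big_split /= sumr_const card_ord mulr_natl.
apply: ler_sum => i _; have := far i; rewrite negb_and -ltNge.
have [iL /= farB|iR _] := boolP (le_med tie I i); last first.
  rewrite -exact_minus//; last exact: le_trans (ltW ym) (gt_med_loc _ iR).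
  by rewrite addrAC (le_trans (ler_normD _ _))// (ger0_norm B0).
have c0 : 0 <= cost y (I i) by rewrite costE.
have yx : y < loc I i.
  by rewrite ltNge; apply/negP => xy; move: farB; rewrite exact_plus//; lra.
have px : loc I i <= p i.
  by rewrite /p /preferred_point iL lerDl; case/andP: (dist_bounded i).
(* Here [p i - y] lies between [cost y (I i) + B] and [cost y (I i) + 2 * B]; the shift by [B] is
   subtracted from it. *)
have := excess_2B i; move: farB.
by rewrite distrC ger0_norm ?subr_ge0 1?ler_norml; lra.
Qed.

Theorem lemma9 (R : realType) (n : nat) (tie : {perm 'I_n}) (B : R)
    (I : instance R n) (n_ge1 : (1 <= n)%N)
    (dist_bounded : forall i : 'I_n, 0 <= dist I i <= B) :
  SC (median_plus tie I) I <= OPT I + n%:R * B.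
Proof.
have [y <- _] := OPT_attained I.
have [z] := preferred_points_near_cost tie y n_ge1 dist_bounded; apply: le_trans.
have := median_minimizes_sum_dist
  [seq preferred_point tie I i | i <- enum 'I_n] z.
rewrite -/(median_plus tie I) !big_image /=; apply: le_trans.
(* Reverse triangle inequality: the preferred point is at distance exactly [b] from [x], as
   [0 <= b]. *)
apply: ler_sum => i _; have /andP[] := dist_bounded i.
rewrite costE /preferred_point /loc /dist; case: (I i) => x b /=.
rewrite ler_norml; have := ler_norm (median_plus tie I - (x + b)).
have := ler_norm (- (median_plus tie I - (x + b))).
have := ler_norm (median_plus tie I - (x - b)).
have := ler_norm (- (median_plus tie I - (x - b))).
by rewrite !normrN; case: ifP => _; case: (ler0P (x - _)) => ?; lra.
Qed.
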